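(* Let $X$ be a second countable topological Baire $T_1$-space without isolated points and let $E\subset X$. If $E$ is everywhere 2nd category in $X$, then $E$ can be decomposed into the union of an infinite number of pairwise disjoint subsets, each of which is everywhere 2nd category in $X$.
   Context: A set is 2nd category if it is not of first category (meager) in $X$. A topological space is a Baire space if its nonempty open subsets are 2nd category. A set $E\subset X$ is 2nd category at a point $x$ if for each neighborhood $V$ of $x$ the intersection $V\cap E$ is 2nd category; $E$ is everywhere 2nd category in $X$ if it is 2nd category at each point $x\in X$. *)

(* Defs.v *)
From HB Require Import structures.
From mathcomp Require Import all_boot all_order.
From mathcomp Require Import mathcomp_extra boolp classical_sets functions.
From mathcomp Require Import cardinality filter topology.

Set Implicit Arguments.
Unset Strict Implicit.
Unset Printing Implicit Defensive.

Local Open Scope classical_set_scope.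

Definition nowhere_dense (X : topologicalType) (A : set X) : Prop :=
  interior (closure A) = set0.

(* Repetitions and empty pieces are allowed in [F], so finite unions and the
   empty set are covered. *)
Definition first_category (X : topologicalType) (A : set X) : Prop :=
  exists F : nat -> set X,
    (forall n, nowhere_dense (F n)) /\ A = \bigcup_n F n.

Definition second_category (X : topologicalType) (A : set X) : Prop :=
  ~ first_category A.

Definition baire_space (X : topologicalType) : Prop :=
  forall U : set X, open U -> U !=set0 -> second_category U.

Definition second_category_at (X : topologicalType) (E : set X) (x : X) : Prop :=
  forall V : set X, nbhs x V -> second_category (V `&` E).

Definition everywhere_second_category (X : topologicalType) (E : set X) : Prop :=
  forall x : X, second_category_at E x.

(* Main.v *)
Require Import Defs.
From HB Require Import structures.
From mathcomp Require Import all_boot all_order.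
From mathcomp Require Import mathcomp_extra boolp classical_sets functions.
From mathcomp Require Import cardinality filter topology.
From mathcomp Require Import wochoice.

Set Implicit Arguments.
Unset Strict Implicit.

Local Open Scope classical_set_scope.

(** The heart of the matter is Lusin's theorem: [E] contains, locally, two
    disjoint pieces that are both everywhere of second category. Well-order
    [X]; cutting [E] at the first non-meager initial segment gives a non-meager
    [A] all of whose proper initial segments are meager (points are meager, as
    [X] is [T1] without isolated points). If no subset of [A] split [A] in this
    way, every subset of [A] would be open modulo meager sets. Covering each
    initial segment [{y <= x}] by nowhere dense sets [N n x], the sets
    [{(x, y) | y \in N n x}] would then be closed up to a meager set of [x],
    and the Kuratowski-Ulam argument would yield a [y] such that [y \notin N n x]
    for all [n] and for a non-meager set of [x], although [y <= x] for all [x]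
    outside a meager set. The local splittings are glued along a countable base,
    and iterating the global splitting gives infinitely many pieces. *)

Section Category.
Variable X : topologicalType.
Implicit Types (A B S V W : set X) (U : nat -> set X).

(** * Nowhere dense and meager sets *)

Lemma nowhere_denseP A :
  nowhere_dense A <-> forall W, open W -> W !=set0 ->
    exists V, [/\ open V, V !=set0, V `<=` W & forall x, V x -> ~ A x].
Proof.
split=> [ndA W oW [x Wx]|h].
  exists (W `\` closure A); split => //.
  - by apply: openI => //; apply: closed_openC; exact: closed_closure.
  - apply: contrapT => W0.
    have : interior (closure A) x.
      suff : W `<=` interior (closure A) by exact.
      rewrite -open_subsetE// => y Wy; apply: contrapT => Ay.
      by apply: W0; exists y.
    by rewrite (ndA : interior (closure A) = set0).
  - by move=> y [_ Ay] /subset_closure.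
rewrite /nowhere_dense -subset0 => x Ax.
have [V [oV [y Vy] VA VnA]] := h _ (@open_interior _ (closure A)) (ex_intro _ x Ax).
have [z [Az Vz]] := interior_subset (VA y Vy) V (open_nbhs_nbhs (conj oV Vy)).
exact: VnA Vz Az.
Qed.

Lemma nowhere_denseS A B : A `<=` B -> nowhere_dense B -> nowhere_dense A.
Proof.
move=> AB /nowhere_denseP ndB; apply/nowhere_denseP => W oW W0.
have [V [oV V0 VW VB]] := ndB W oW W0.
by exists V; split => // x Vx /AB; exact: VB.
Qed.

Lemma first_categoryP A :
  first_category A <->
  exists2 F : nat -> set X, forall n, nowhere_dense (F n) & A `<=` \bigcup_n F n.
Proof.
split=> [[F [ndF ->]]|[F ndF AF]]; first by exists F.
exists (fun n => F n `&` A); split.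
  by move=> n; apply: nowhere_denseS (ndF n) => x [].
by rewrite -setI_bigcupl; apply/esym/setIidr.
Qed.

Lemma first_categoryS A B : A `<=` B -> first_category B -> first_category A.
Proof.
move=> AB /first_categoryP[F ndF BF]; apply/first_categoryP; exists F => //.
exact: subset_trans BF.
Qed.

Lemma second_categoryS A B : A `<=` B -> second_category A -> second_category B.
Proof. by move=> AB cA /(first_categoryS AB). Qed.

Lemma first_category_nowhere_dense A : nowhere_dense A -> first_category A.
Proof.
by move=> ndA; apply/first_categoryP; exists (fun=> A) => // x Ax; exists 0%N.
Qed.

Lemma first_category0 : first_category (@set0 X).
Proof.
apply/first_category_nowhere_dense/nowhere_denseP => W oW W0.
by exists W; split => // x _; exact.
Qed.

Lemma first_category_bigcup (P : set nat) (F : nat -> set X) :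
  (forall n, P n -> first_category (F n)) ->
  first_category (\bigcup_(n in P) F n).
Proof.
move=> fcF.
have /choice[G GP] n : exists G : nat -> set X,
    (forall m, nowhere_dense (G m)) /\ (P n -> F n `<=` \bigcup_m G m).
  have [Pn|nPn] := pselect (P n).
    by have /first_categoryP[G ndG FG] := fcF n Pn; exists G.
  have /first_categoryP[G ndG _] := first_category0.
  by exists G; split.
apply/first_categoryP.
(* [pickle] flattens the double index; codes of no pair receive a fixed nowhere dense set. *)
exists (fun k => if unpickle k is Some (n, m) then G n m else G 0%N 0%N).
  by move=> k; case: unpickle => [[n m]|]; exact: (GP _).1.
move=> x [n Pn Fx]; have [m _ Gx] := (GP n).2 Pn x Fx.
by exists (pickle (n, m)) => //; rewrite pickleK.
Qed.

Lemma first_categoryU A B :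
  first_category A -> first_category B -> first_category (A `|` B).
Proof.
move=> fcA fcB.
apply: (@first_categoryS _ (\bigcup_(n in setT) (if n is 0%N then A else B))).
  by move=> x [Ax|Bx]; [exists 0%N|exists 1%N].
by apply: first_category_bigcup => -[|n] _.
Qed.

Lemma second_category_ex A B :
  second_category A -> first_category B -> exists2 x, A x & ~ B x.
Proof.
move=> scA fcB; apply: contrapT => h; apply: scA; apply: first_categoryS fcB.
by move=> x Ax; apply: contrapT => Bx; apply: h; exists x.
Qed.

(** Removing [x] from an open set leaves an open set, and leaves nothing only if [x] was
    isolated. *)
Lemma nowhere_dense_set1 (x : X) :
  accessible_space X -> isolated [set: X] = set0 -> nowhere_dense [set x].
Proof.
move=> T1 noiso; apply/nowhere_denseP => W oW [z Wz].
have op : open (~` [set x]).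
  by apply: closed_openC; exact: accessible_closed_set1.
exists (W `\` [set x]); split; [exact: openI| |by move=> ? []|by move=> ? []].
apply: contrapT => W0.
have Wx y : W y -> y = x.
  by move=> Wy; apply: contrapT => yx; apply: W0; exists y.
have : isolated [set: X] x.
  split; first by rewrite inE.
  exists W; first by apply: open_nbhs_nbhs; split => //; rewrite -(Wx z Wz).
  rewrite setIT; apply/seteqP; split => y; first exact: Wx.
  by move=> ->; rewrite -(Wx z Wz).
by rewrite noiso.
Qed.

(** * Countable bases and localized category *)

Definition open_base U : Prop :=
  (forall n, open (U n)) /\
  forall W x, open W -> W x -> exists n, U n x /\ U n `<=` W.

Lemma second_countable_base : @second_countable X -> exists U, open_base U.
Proof.
move=> [B /countable_injP[f finj] [Bop Bnbhs]].
(* Since [f] is injective on [B], each union has at most one member; it is empty when [n] codes no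
   member. *)
exists (fun n => \bigcup_(b in [set b | B b /\ f b = n]) b); split.
  by move=> n; apply: bigcup_open => b [/Bop].
move=> W x oW Wx.
have [V [BV Vx] VW] := Bnbhs x W (open_nbhs_nbhs (conj oW Wx)).
exists (f V); split; first by exists V.
move=> y [b [Bb fb] bz]; apply: VW.
by rewrite (finj V b) ?inE.
Qed.

Definition everywhere_second_category_in V A : Prop :=
  forall W, open W -> W !=set0 -> W `<=` V -> second_category (W `&` A).

Lemma everywhere_second_categoryP A :
  everywhere_second_category A <-> everywhere_second_category_in setT A.
Proof.
split=> [h W oW [x Wx] _|h x V].
  by apply: (h x); exact: open_nbhs_nbhs.
rewrite nbhsE => -[W [oW Wx] WV].
apply: second_categoryS (h W oW (ex_intro _ x Wx) (@subsetT _ W)).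
exact: setSI.
Qed.

Lemma everywhere_second_categoryS A B :
  A `<=` B -> everywhere_second_category A -> everywhere_second_category B.
Proof.
by move=> AB h x V Vx; apply: second_categoryS (h x V Vx); exact: setIS.
Qed.

Lemma not_everywhere_second_category_in V A :
  ~ everywhere_second_category_in V A ->
  exists W, [/\ open W, W !=set0, W `<=` V & first_category (W `&` A)].
Proof.
move=> h; apply: contrapT => nex; apply: h => W oW W0 WV fc.
by apply: nex; exists W.
Qed.

(** Otherwise the basic sets in which [A] is meager are dense in [V]. They carry a meager part of
    [A], and what they leave of [V] is nowhere dense. *)
Lemma second_category_somewhere U A V :
  open_base U -> open V -> second_category (V `&` A) ->
  exists W, [/\ open W, W !=set0, W `<=` V & everywhere_second_category_in W A].
Proof.
move=> [oU bU] oV scA; apply: contrapT => h; apply: scA.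
pose P := [set n | first_category (U n `&` A)].
apply: (@first_categoryS _
  (\bigcup_(n in P) (U n `&` A) `|` (V `\` \bigcup_(n in P) U n))).
  move=> x [Vx Ax]; have [[n Pn Ux]|nx] := pselect ((\bigcup_(n in P) U n) x).
    by left; exists n.
  by right.
apply: first_categoryU; first exact: first_category_bigcup.
apply/first_category_nowhere_dense/nowhere_denseP => W oW W0.
have [[x [Wx Vx]]|WV0] := pselect ((W `&` V) !=set0); last first.
  by exists W; split => // x Wx [Vx _]; apply: WV0; exists x.
have /not_everywhere_second_category_in[O [oO [y Oy] OWV fcO]] :
    ~ everywhere_second_category_in (W `&` V) A.
  by move=> e; apply: h; exists (W `&` V); split => //;
    [exact: openI|exists x].
have [n [Uy UO]] := bU O y oO Oy.
exists (U n); split => //; first by exists y.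
  by move=> z /UO/OWV[].
move=> z Uz [_]; apply; exists n => //.
by apply: first_categoryS fcO; exact: setSI.
Qed.

(** * Local splitting along a well-order *)

Lemma open_mod_first_category U A V S : open_base U -> open V ->
  (forall W, open W -> W !=set0 -> W `<=` V ->
     ~ (everywhere_second_category_in W (A `&` S) /\
        everywhere_second_category_in W (A `\` S))) ->
  exists2 G, open G & first_category (V `&` A `&` [set x | ~ (S x <-> G x)]).
Proof.
move=> [oU bU] oV nosplit.
(* Without splittings, the basic sets indexed by [P] or [Q] are dense in [V]. With the union over
   [P] as [G], all errors lie in countably many meager pieces and a nowhere dense remainder. *)
pose P := [set n | first_category (U n `&` (A `\` S))].
pose Q := [set n | first_category (U n `&` (A `&` S))].
exists (\bigcup_(n in P) U n); first exact: bigcup_open.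
apply: (@first_categoryS _
  ((\bigcup_(n in P) (U n `&` (A `\` S)) `|` \bigcup_(n in Q) (U n `&` (A `&` S)))
   `|` (V `\` (\bigcup_(n in P) U n `|` \bigcup_(n in Q) U n)))).
  move=> x [[Vx Ax] SGx]; apply: contrapT => /not_orP[/not_orP[nP nQ] nR].
  apply: SGx; split=> [Sx|[n Pn Ux]]; last first.
    by apply: contrapT => Sx; apply: nP; exists n.
  apply: contrapT => nG; apply: nR; split => // -[//|[n Qn Ux]].
  by apply: nQ; exists n.
apply: first_categoryU.
  by apply: first_categoryU; exact: first_category_bigcup.
apply/first_category_nowhere_dense/nowhere_denseP => W oW W0.
have [[x [Wx Vx]]|WV0] := pselect ((W `&` V) !=set0); last first.
  by exists W; split => // x Wx [Vx _]; apply: WV0; exists x.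
have /not_andP nWV := nosplit (W `&` V) (openI oW oV)
  (ex_intro _ x (conj Wx Vx)) (@subIsetr _ _ _).
have [O [oO [y Oy] OWV fcO]] : exists O, [/\ open O, O !=set0, O `<=` W `&` V &
    first_category (O `&` (A `\` S)) \/ first_category (O `&` (A `&` S))].
  by case: nWV => /not_everywhere_second_category_in[O [oO O0 OWV fcO]];
    exists O; split => //; [right|left].
have [n [Uy UO]] := bU O y oO Oy.
exists (U n); split => //; first by exists y.
  by move=> z /UO/OWV[].
move=> z Uz [_]; apply.
by case: fcO => fcO; [left|right]; exists n => //;
  apply: first_categoryS fcO; exact: setSI.
Qed.

(* [r] plays the role of a well-order whose proper initial segments are meager. *)
Lemma second_category_split U A V (r : X -> X -> Prop) :
  open_base U -> open V -> V !=set0 -> everywhere_second_category_in V A ->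
  (forall x, A x -> first_category (A `&` [set y | r y x])) ->
  (forall y, A y -> first_category (A `&` [set x | ~ r y x])) ->
  exists W S, [/\ open W, W !=set0, W `<=` V,
    everywhere_second_category_in W (A `&` S) &
    everywhere_second_category_in W (A `\` S)].
Proof.
move=> bU oV V0 scA rl rr; apply: contrapT => nosplit.
have /choice[N NP] x : exists N : nat -> set X,
    (forall n, nowhere_dense (N n)) /\
    (A x -> A `&` [set y | r y x] `<=` \bigcup_n N n).
  have [Ax|nAx] := pselect (A x).
    by have /first_categoryP[N ndN rN] := rl x Ax; exists N.
  have /first_categoryP[N ndN _] := first_category0.
  by exists N; split.
(* For fixed [x] and [n], the [U k] with [S (n, k) x] fill the complement of the closure of [N x n].
   Each [S p] agrees on [V] and [A] with an open [G p] up to a meager set. *)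
pose S (p : nat * nat) := [set x | forall y, U p.2 y -> ~ N x p.1 y].
have /choice[G GP] p : exists G, open G /\
    first_category (V `&` A `&` [set x | ~ (S p x <-> G x)]).
  have [|G oG fcG] := @open_mod_first_category U A V (S p) bU oV.
    by move=> W oW W0 WV [e1 e2]; apply: nosplit; exists W, (S p); split.
  by exists G.
pose M := \bigcup_n \bigcup_k
  (V `&` A `&` [set x | ~ (S (n, k) x <-> G (n, k) x)]).
have fcM : first_category M.
  by apply: first_category_bigcup => n _; apply: first_category_bigcup => k _;
    exact: (GP _).2.
have MP x n k : V x -> A x -> ~ M x -> (S (n, k) x <-> G (n, k) x).
  move=> Vx Ax nM; apply: contrapT => SG; apply: nM.
  by exists n => //; exists k.
case: (bU) => oU bU'.
(* The rectangles [G (n, k)] times [U k] form an open set of the plane; [O n j] is the projection to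
   the second axis of its part over [U j]. *)
pose O n j := \bigcup_(k in [set k | U j `&` G (n, k) !=set0]) U k.
pose J := [set j | U j !=set0 /\ U j `<=` V].
have fcO : first_category (\bigcup_n \bigcup_(j in J) ~` O n j).
  apply: first_category_bigcup => n _; apply: first_category_bigcup => j [U0 UV].
  apply/first_category_nowhere_dense/nowhere_denseP => W oW W0.
  (* [N x n] is nowhere dense, so some basic set inside [W] avoids it; as [x] lies outside [M], that
     basic set is part of [O n j]. *)
  have [x [Ux Ax] nMx] := second_category_ex (scA _ (oU j) U0 UV) fcM.
  have /nowhere_denseP/(_ W oW W0)[T [oT [z Tz] TW TN]] := (NP x).1 n.
  have [k [Uz UT]] := bU' T z oT Tz.
  exists (U k); split => //; [by exists z|by move=> ? /UT/TW|].
  move=> t Ut; apply; exists k => //; exists x; split => //.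
  apply/MP => //; first exact: UV.
  by move=> s /UT; exact: TN.
have scV : second_category (V `&` A) by exact: scA.
(* Lying in [O n j] for all [n] and all [j] in [J], [y] has horizontal sections [Z n] that are dense
   in [V]. *)
have [y [Vy Ay] nOy] := second_category_ex scV fcO.
pose Z n := \bigcup_(k in [set k | U k y]) G (n, k).
have fcZ : first_category (\bigcup_n (V `\` Z n)).
  apply: first_category_bigcup => n _.
  apply/first_category_nowhere_dense/nowhere_denseP => W oW W0.
  have [[x WVx]|WV0] := pselect ((W `&` V) !=set0); last first.
    by exists W; split => // x Wx [Vx _]; apply: WV0; exists x.
  have [j [Ux UWV]] := bU' (W `&` V) x (openI oW oV) WVx.
  have [k [z Uz] Uy] : O n j y.
    apply: contrapT => nO; apply: nOy; exists n => //; exists j => //.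
    by split; [exists x|move=> ? /UWV[]].
  exists (U j `&` G (n, k)); split.
  - by apply: openI => //; exact: (GP _).1.
  - by exists z.
  - by move=> t [/UWV[]].
  - by move=> t [_ Gt] [_]; apply; exists k.
(* Such an [x] lies above [y], so some [N x n] contains [y], whereas [x] in [Z n] and outside [M]
   forbids it. *)
have [x [Vx Ax]] := second_category_ex scV
  (first_categoryU fcM (first_categoryU fcZ (rr y Ay))).
move=> /not_orP[nMx /not_orP[nZx nrx]].
have ryx : r y x by apply: contrapT => nr; apply: nrx.
have [n _ Ny] := (NP x).2 Ax y (conj Ay ryx).
have [k Uy Gx] : Z n x.
  by apply: contrapT => nZ; apply: nZx; exists n.
have /(_ y Uy) := (MP x n k Vx Ax nMx).2 Gx.
exact.
Qed.

Lemma local_split U A V : open_base U ->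
  accessible_space X -> isolated [set: X] = set0 ->
  open V -> second_category (V `&` A) ->
  exists W S, [/\ open W, W !=set0, W `<=` V,
    everywhere_second_category_in W (A `&` S) &
    everywhere_second_category_in W (A `\` S)].
Proof.
move=> bU T1 noiso oV scA.
have [R woR] := well_ordering_principle X.
have woT : wo_chain R predT by exact: withinW.
have Rtot x y : R x y \/ R y x by apply/orP; exact: (wo_chainW woT).
have Ranti x y : R x y -> R y x -> x = y.
  by move=> xy yx; apply: (wo_chain_antisymmetric woT) => //; apply/andP.
pose L := [set x | first_category (V `&` A `&` [set y | R y x])].
have scL : second_category (V `&` (V `&` A `&` L)).
  move=> fcL; have [LT|/existsNP[x nLx]] := pselect (forall x, L x).
    by apply: scA; apply: first_categoryS fcL => x [Vx Ax]; do !split.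
  (* The least [z] outside [L] has only points of [L] and itself in its segment, which is then
     meager. *)
  have [|z [[]]] := woR [pred t | `[< ~ L t >]].
    by exists x; exact: (asboolT nLx).
  move=> /asboolP nLz zmin _; apply: nLz.
  have fcz : first_category [set z].
    exact/first_category_nowhere_dense/nowhere_dense_set1.
  apply: first_categoryS (first_categoryU fcL fcz) => y [[Vy Ay] Ryz].
  have [Ly|nLy] := pselect (L y); first by left; do !split.
  by right; apply: Ranti => //; apply: zmin; exact: (asboolT nLy).
have [W [oW W0 WV eW]] := second_category_somewhere bU oV scL.
have [||W' [S [oW' W'0 W'W e1 e2]]] :=
    @second_category_split U (V `&` A `&` L) W R bU oW W0 eW.
- by move=> x [_ Lx]; apply: first_categoryS Lx => y [[]].
(* By totality, points not above [y] lie in the initial segment of [y]. *)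
- move=> y [_ Ly]; apply: first_categoryS Ly => x [[VAx _] nR]; split => //=.
  by case: (Rtot x y).
exists W', S; split => //; first exact: subset_trans WV.
  by move=> T oT T0 TW; apply: second_categoryS (e1 T oT T0 TW) => x [? [[[]]]].
by move=> T oT T0 TW; apply: second_categoryS (e2 T oT T0 TW) => x [? [[[]]]].
Qed.

(** * Gluing and iterating the splittings *)

(* At a point of the union of the open sets [D n], the local splitting [S n]
   with the least possible [n] is used. *)
Lemma everywhere_split U A : open_base U ->
  accessible_space X -> isolated [set: X] = set0 ->
  everywhere_second_category A ->
  exists S, everywhere_second_category (A `&` S) /\
            everywhere_second_category (A `\` S).
Proof.
move=> bU T1 noiso /everywhere_second_categoryP eA; case: (bU) => oU bU'.
have /choice[DS DSP] n : exists DS : set X * set X, [/\ open DS.1,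
    U n !=set0 -> DS.1 !=set0, DS.1 `<=` U n,
    everywhere_second_category_in DS.1 (A `&` DS.2) &
    everywhere_second_category_in DS.1 (A `\` DS.2)].
  have [U0|nU0] := pselect (U n !=set0); last first.
    exists (set0, set0).
    by split => //=; first exact: open0; move=> O oO [x Ox] /(_ x Ox).
  have [W [S [oW W0 WU e1 e2]]] :=
      local_split bU T1 noiso (oU n) (eA _ (oU n) U0 (@subsetT _ _)).
    by exists (W, S); split.
pose D n := (DS n).1.
pose first n := [set x | D n x /\ forall m, (m < n)%N -> ~ D m x].
have first_inj m n x : first m x -> first n x -> m = n.
  move=> [Dm mm] [Dn mn]; case: (ltngtP m n) => // lt.
    by case: (mn _ lt).
  by case: (mm _ lt).
have first_open W : open W -> W !=set0 ->
    exists n O, [/\ open O, O !=set0, O `<=` W & O `<=` first n].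
  move=> oW [x Wx]; have [n [Ux UW]] := bU' W x oW Wx.
  have [oD /(_ (ex_intro _ x Ux)) [y Dy] DU _ _] := DSP n.
  (* For the least [m] with [D m] meeting [W], no earlier [D k] meets [W], so [first m] contains all
     of [W] inside [D m]. *)
  have exn : exists n, `[< W `&` D n !=set0 >].
    by exists n; apply/asboolP; exists y; split => //; exact/UW/DU.
  case: (ex_minnP exn) => m /asboolP Wm mmin.
  exists m, (W `&` D m); split => //; first by apply: openI => //; case: (DSP m).
  move=> z [Wz Dz]; split => // k km Dk.
  have : (m <= k)%N by apply: mmin; apply/asboolP; exists z.
  by rewrite leqNgt km.
(* As the sets [first n] are disjoint, this union reduces to [(DS n).2] inside [first n]. *)
exists (\bigcup_n (first n `&` (DS n).2)).
split; apply/everywhere_second_categoryP => W oW W0 _;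
  have [n [O [oO O0 OW On]]] := first_open W oW W0;
  have OD : O `<=` D n by move=> z /On[].
  have [_ _ _ /(_ O oO O0 OD) + _] := DSP n; apply: second_categoryS.
  by move=> x [Ox [Ax Sx]]; split; [exact: OW|split => //; exists n => //;
    split => //; exact: On].
have [_ _ _ _ /(_ O oO O0 OD)] := DSP n; apply: second_categoryS.
move=> x [Ox [Ax Sx]]; split; first exact: OW.
by split => // -[m _ [fm]]; rewrite (first_inj _ _ _ fm (On _ Ox)).
Qed.

End Category.

Theorem corollary3p5 (X : topologicalType)
  (X_second_countable : @second_countable X)
  (X_baire : baire_space X)
  (X_T1 : accessible_space X)
  (X_no_isolated : isolated [set: X] = set0)
  (E : set X)
  (E_everywhere : everywhere_second_category E) :
  exists (I : Type) (F : I -> set X),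
    [/\ infinite_set [set: I],
        trivIset [set: I] F,
        E = \bigcup_i F i &
        forall i : I, everywhere_second_category (F i)].
Proof.
have [U bU] := second_countable_base X_second_countable.
have /choice[h hP] (A : set X) : exists S, everywhere_second_category A ->
    everywhere_second_category (A `&` S) /\
    everywhere_second_category (A `\` S).
  have [eA|nA] := pselect (everywhere_second_category A); last by exists set0.
  by have [S SP] := everywhere_split bU X_T1 X_no_isolated eA; exists S.
(* [rest n] is what [n] splittings leave; the half [piece n] is split off from it next. *)
pose rest n := iter n (fun A => A `\` h A) E.
have rest_ev n : everywhere_second_category (rest n).
  by elim: n => [//|n IH]; exact: (hP _ IH).2.
have restS m n x : (m <= n)%N -> rest n x -> rest m x.
  move=> /subnK <-; elim: (n - m)%N => [//|k IH].
  by rewrite addSn => -[/IH].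
pose piece n := rest n `&` h (rest n).
have piece_inj m n x : piece m x -> piece n x -> m = n.
  move=> [rm hm] [rn hn]; case: (ltngtP m n) => // lt.
    (* [m < n] puts [rest n] inside [rest m.+1], from which [h (rest m)] was removed. *)
    by have [] := restS _ _ _ lt rn.
  by have [] := restS _ _ _ lt rm.
(* Points never split off join [piece 0], so that the pieces exhaust [E]; enlarging a piece
   preserves its category. *)
pose left := [set x | E x /\ forall n, ~ piece n x].
exists nat, (fun n => piece n `|` (if n is 0%N then left else set0)); split.
- exact: infinite_nat.
- move=> m n _ _ [x [Fm Fn]].
  case: Fm => [pm|]; case: Fn => [pn|].
  + exact: piece_inj pm pn.
  + by case: n => // -[_ /(_ _ pm)].
  + by case: m => // -[_ /(_ _ pn)].
  + by case: m => //; case: n.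
- apply/seteqP; split => x.
    move=> Ex; have [[n pn]|np] := pselect (exists n, piece n x).
      by exists n => //; left.
    exists 0%N => //; right; split => // n pn.
    by apply: np; exists n.
  move=> [n _ [[rn _]|]]; first exact: (restS 0%N n).
  by case: n => // -[].
- move=> n; apply: everywhere_second_categoryS (hP _ (rest_ev n)).1.
  by move=> x; left.
Qed.
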